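(* Let $\ell\ge r\ge 3$ be integers and let $\varepsilon=\binom{\ell-1}{r-1}\left(\frac{1}{\ell^{r-1}}-\left(\frac{3\ell-4}{3\ell^2-4\ell+1}\right)^{r-1}\right)$. Then every $\mathcal{K}_{\ell+1}^r$-free $r$-graph $\mathcal{H}$ on $n$ vertices with $\delta(\mathcal{H})>\left(\binom{\ell-1}{r-1}/\ell^{r-1}-\varepsilon\right)n^{r-1}$ is $\ell$-partite.
   Context: An $r$-graph is a set of vertices with a collection of $r$-element subsets (edges). For integers $\ell\ge r\ge 2$, $\mathcal{K}_{\ell+1}^r$ is the family of all $r$-graphs $F$ with at most $\binom{\ell+1}{2}$ edges such that for some $(\ell+1)$-set $S$ of vertices, every pair $\{u,v\}\subset S$ is contained in some edge of $F$; $\mathcal{H}$ is $\mathcal{K}_{\ell+1}^r$-free if it contains no member of this family as a subgraph. $\delta(\mathcal{H})$ is the minimum, over vertices $v$, of the number of edges containing $v$. $\mathcal{H}$ is $\ell$-partite if its vertex set can be partitioned into $\ell$ parts so that every edge meets each part in at most one vertex. *)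

(* Defs.v *)
From mathcomp Require Import all_boot all_order all_algebra.

Set Implicit Arguments.
Unset Strict Implicit.
Unset Printing Implicit Defensive.

Record r_graph (r : nat) (V : finType) := RGraph {
  edges : {set {set V}};
  edges_uniform : forall e : {set V}, e \in edges -> #|e| = r
}.

Definition degree (r : nat) (V : finType) (H : r_graph r V) (v : V) : nat :=
  #|[set e in edges H | v \in e]|.

(* Every degree is at most #|edges H|, so the initial value of the iterated   *)
(* minimum never affects the result on a nonempty vertex set; it only fixes   *)
(* the value on the empty one.                                                *)
Definition min_degree (r : nat) (V : finType) (H : r_graph r V) : nat :=
  \big[minn/#|edges H|]_(v : V) degree H v.

(* Containment as a not necessarily induced subgraph, up to isomorphism.      *)
Definition contains (r : nat) (V W : finType)
    (H : r_graph r V) (F : r_graph r W) : Prop :=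
  exists f : W -> V,
    injective f /\ (forall e : {set W}, e \in edges F -> f @: e \in edges H).

(* in_K m F is membership of F in the family K_m^r.                           *)
Definition in_K (m r : nat) (W : finType) (F : r_graph r W) : Prop :=
  #|edges F| <= 'C(m, 2) /\
  exists S : {set W},
    #|S| = m /\
    (forall u v : W, u \in S -> v \in S -> u != v ->
       exists e : {set W}, [/\ e \in edges F, u \in e & v \in e]).

Definition K_free (m r : nat) (V : finType) (H : r_graph r V) : Prop :=
  forall (W : finType) (F : r_graph r W), in_K m F -> ~ contains H F.

(* Parts are allowed to be empty.                                             *)
Definition partite (l r : nat) (V : finType) (H : r_graph r V) : Prop :=
  exists P : 'I_l -> {set V},
    [/\ \bigcup_(i < l) P i = [set: V],
        forall i j : 'I_l, i != j -> [disjoint P i & P j]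
      & forall (e : {set V}) (i : 'I_l), e \in edges H -> #|e :&: P i| <= 1].

(* Main.v *)
(* Let G be the shadow of H: two vertices are adjacent when some edge of H     *)
(* contains both. G has no (l+1)-clique, so the neighbourhood of a vertex v    *)
(* has no l-clique, while every edge of H through v gives an (r-1)-clique      *)
(* there. Zykov's theorem bounds the number of these by                        *)
(* C(l-1, r-1) (d_G(v) / (l-1))^(r-1), and as                                  *)
(* 3 l^2 - 4 l + 1 = (3 l - 1) (l - 1), the degree hypothesis forces           *)
(* d_G(v) > (3 l - 4) / (3 l - 1) n. The theorem of Andrasfai, Erdos and Sos   *)
(* then colours G with l colours. For it we follow Brandt: an edge-maximal     *)
(* graph without (l+1)-clique either is complete multipartite or contains a    *)
(* "five-wheel" made of two (l-1)-cliques, and the degree condition would      *)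
(* allow the intersection of these two cliques to grow forever.                *)

Require Import Defs.
From mathcomp Require Import all_boot all_order all_algebra.
From mathcomp Require Import zify ring lra.
Import Order.TTheory GRing.Theory Num.Theory.

Set Implicit Arguments.
Unset Strict Implicit.
Unset Printing Implicit Defensive.

(** The degree threshold in the theorem is exactly the bound of [degree_le] for a vertex with
    [(3l-4)/(3l-1) n] neighbours in the shadow. The hypothesis thus turns into the
    Andrasfai-Erdos-Sos degree condition on the shadow, and a proper [l]-colouring of the shadow is
    an [l]-partition of the hypergraph because every edge is a shadow clique.

    [zykov] reduces by symmetrisation to weights on a clique, where Maclaurin's inequality applies
    ([clique_sum_clique]). [andrasfai_erdos_sos] adds edges while no [l.+1]-clique appears. In the
    final graph non-adjacency is transitive, since a violation would give a five-wheel, excluded by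
    [no_five_wheel]; [colouring_of_multipartite] then colours it. *)

Section Cliques.
Variables (V : finType) (e : rel V).
Hypotheses (e_sym : symmetric e) (e_irr : irreflexive e).
Implicit Types (A B S K Q : {set V}) (s k l : nat).

Definition clique (d : rel V) S :=
  [forall x in S, forall y in S, (x != y) ==> d x y].

Definition clique_bound (d : rel V) l := [forall S, clique d S ==> (#|S| <= l)].

Definition nbr x := [set y | e x y].

Lemma cliqueP (d : rel V) S :
  reflect {in S &, forall x y, x != y -> d x y} (clique d S).
Proof.
apply: (iffP forall_inP) => [h x y xS yS nxy | h x xS].
  by have /forall_inP/(_ y yS)/implyP := h x xS; apply.
by apply/forall_inP => y yS; apply/implyP; apply: h.
Qed.

Lemma clique_boundP (d : rel V) l :
  reflect (forall S, clique d S -> #|S| <= l) (clique_bound d l).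
Proof. by apply: (iffP forallP) => h S; [apply/implyP | apply/implyP/h]. Qed.

Lemma cliqueS (d : rel V) S (T : {set V}) : S \subset T -> clique d T -> clique d S.
Proof.
move=> /subsetP sub /cliqueP h; apply/cliqueP => x y xS yS.
by apply: h; apply: sub.
Qed.

Lemma cliqueU1 x S : {in S, forall y, e y x} -> clique e S -> clique e (x |: S).
Proof.
move=> hx /cliqueP h; apply/cliqueP => y z.
case/setU1P=> [->|yS]; case/setU1P=> [->|zS]; first by rewrite eqxx.
- by rewrite e_sym => _; apply: hx.
- by move=> _; apply: hx.
- exact: h.
Qed.

(** * Weighted clique counts: Maclaurin's inequality and Zykov's theorem *)

Section WeightedCount.
Variable F : realFieldType.
Implicit Types w : V -> F.
Local Open Scope ring_scope.

Definition clique_sum s A w : F :=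
  \sum_(S : {set V} | [&& S \subset A, #|S| == s & clique e S])
     \prod_(v in S) w v.

Lemma clique_sum0 A w : clique_sum 0 A w = 1.
Proof.
rewrite /clique_sum (big_pred1 set0) ?big_set0 // => S /=.
rewrite cards_eq0; case: eqVneq => [->|]; last by rewrite andbF.
by rewrite sub0set; apply/cliqueP => x y; rewrite inE.
Qed.

Lemma eq_clique_sum s A w w' :
  {in A, w =1 w'} -> clique_sum s A w = clique_sum s A w'.
Proof.
move=> eqw; apply: eq_bigr => S /and3P[/subsetP sub _ _].
by apply: eq_bigr => v /sub; apply: eqw.
Qed.

Lemma clique_sum_rec s A w v : v \in A ->
  clique_sum s.+1 A w =
  clique_sum s.+1 (A :\ v) w + w v * clique_sum s ((A :\ v) :&: nbr v) w.
Proof.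
move=> vA; rewrite /clique_sum (bigID (fun S : {set V} => v \in S)) /= addrC.
congr (_ + _).
  apply: eq_bigl => S; rewrite subsetD1.
  by case: (v \in S); rewrite ?andbF ?andbT.
rewrite big_distrr /=.
rewrite (reindex_onto (fun S => v |: S) (fun S => S :\ v)) /=; last first.
  by move=> S /andP[_ vS]; rewrite setD1K.
apply: eq_big => [S|S]; last first.
  by move=> /andP[_ /eqP SE]; rewrite big_setU1 // -SE !inE eqxx.
rewrite subsetI; have [vS|vS] := boolP (v \in S).
  have -> : ((v |: S) :\ v == S) = false.
    by apply: contraTF vS => /eqP <-; rewrite !inE eqxx.
  by rewrite andbF subsetD1 vS andbF.
rewrite setU1K // eqxx setU11 !andbT cardsU1 vS add1n eqSS.
rewrite subUset sub1set vA subsetD1 vS andbT /=.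
apply/and3P/and3P => [[SA sz cl]|[/andP[SA /subsetP SN] sz cl]]; split=> //.
- rewrite SA; apply/subsetP => x xS; rewrite inE.
  move/cliqueP: cl; apply; rewrite ?inE ?eqxx ?xS ?orbT //.
  by apply: contraNneq vS => ->.
- exact: cliqueS (subsetUr _ _) cl.
- by apply: cliqueU1 cl => y /SN; rewrite inE e_sym.
Qed.

(** AM-GM for one copy of [a ^+ s.+1] and [s] copies of [t ^+ s.+1]. *)
Lemma am_gm_pow s (a t : F) : 0 <= a -> 0 <= t ->
  s.+1%:R * a * t ^+ s <= a ^+ s.+1 + s%:R * t ^+ s.+1.
Proof.
move=> a0 t0; elim: s => [|s IH]; first by rewrite expr0 expr1 mul0r; lra.
have {IH} := ler_wpM2l t0 IH.
have mono : 0 <= (a - t) * (a ^+ s.+1 - t ^+ s.+1).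
  have [le_at|/ltW le_ta] := leP a t.
    by rewrite mulr_le0 // subr_le0 // lerXn2r.
  by rewrite mulr_ge0 // subr_ge0 // lerXn2r.
move: mono; rewrite (exprS a s.+1) !(exprS t) -[s.+2%:R]natr1 -[s.+1%:R]natr1.
set p := t ^+ s; set q := a ^+ s.+1.
lra.
Qed.

(** The induction step of Maclaurin's inequality: [t] is the mean of [m] weights, [a] the mean after
    one more is added, and [m.+1 * a - m * t] is the new weight. The absorption identity for
    binomials reduces it to [am_gm_pow] scaled by ['C(m.+1, s.+1)]. *)
Lemma bin_mean_step m s (a t : F) : 0 <= a -> 0 <= t ->
  'C(m, s.+1)%:R * t ^+ s.+1 + (m.+1%:R * a - m%:R * t) * ('C(m, s)%:R * t ^+ s)
  <= 'C(m.+1, s.+1)%:R * a ^+ s.+1.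
Proof.
move=> a0 t0; have := am_gm_pow s a0 t0.
have : 0 <= 'C(m.+1, s.+1)%:R :> F by [].
have : m.+1%:R * 'C(m, s)%:R = s.+1%:R * 'C(m.+1, s.+1)%:R :> F.
  by rewrite -!natrM mul_bin_diag.
rewrite binS natrD.
move: 'C(m, s.+1)%:R 'C(m, s)%:R => c1 c diag c_ge0 /(ler_wpM2l c_ge0).
move: diag; rewrite (exprS t) -[m.+1%:R]natr1 -[s.+1%:R]natr1.
set p := t ^+ s; set q := a ^+ s.+1 => diag le_q.
suff -> : c1 * (t * p) + ((m%:R + 1) * a - m%:R * t) * (c * p) =
   (c1 + c) * ((s%:R + 1) * a * p) - (c1 + c) * (s%:R * (t * p)) by lra.
have -> : ((m%:R + 1) * a - m%:R * t) * (c * p) =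
  ((m%:R + 1) * c) * (a - t) * p + c * t * p by ring.
by rewrite diag; ring.
Qed.

(** Each increment of [k] is [bin_mean_step] with a new weight equal to zero. *)
Lemma bin_mean_mono s m k (X : F) : 0 <= X -> (m <= k)%N ->
  'C(m, s)%:R * (X / m%:R) ^+ s <= 'C(k, s)%:R * (X / k%:R) ^+ s.
Proof.
move=> X0; elim: k => [|k IH]; first by rewrite leqn0 => /eqP ->.
rewrite leq_eqVlt => /predU1P[-> //|/IH {}IH]; apply: le_trans IH _.
case: s => [|s]; first by rewrite !bin0.
case: k => [|k]; first by rewrite bin0n mul0r mulr_ge0 // exprn_ge0 // divr_ge0.
have mean_ge0 j : 0 <= X / j%:R by rewrite divr_ge0.
apply: le_trans (bin_mean_step k.+1 s (mean_ge0 k.+2) (mean_ge0 k.+1)).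
by rewrite ![_.+1%:R * (_ / _)]mulrC !divfK ?pnatr_eq0 // subrr mul0r addr0.
Qed.

(** On a clique the sum is the elementary symmetric polynomial of the weights, so this is
    Maclaurin's inequality. *)
Lemma clique_sum_clique s A w : (forall v, 0 <= w v) -> clique e A ->
  clique_sum s A w <= 'C(#|A|, s)%:R * ((\sum_(v in A) w v) / #|A|%:R) ^+ s.
Proof.
move=> w0; move: {2}#|A| (erefl #|A|) => m; elim: m s A => [|m IH] [|s] A cA clA;
  rewrite ?clique_sum0 ?bin0 ?mulr1 //.
  move/eqP: cA; rewrite cards_eq0 => /eqP ->.
  rewrite cards0 bin0n mul0r /clique_sum big_pred0 // => S.
  by rewrite subset0; case: eqP => // ->; rewrite cards0.
have /card_gt0P[v vA] : (0 < #|A|)%N by rewrite cA.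
have cAv : #|A :\ v| = m by move: cA; rewrite (cardsD1 v) vA => -[].
have clAv : clique e (A :\ v) by apply: cliqueS clA; apply: subD1set.
rewrite (clique_sum_rec _ _ vA).
have -> : (A :\ v) :&: nbr v = A :\ v.
  apply/setIidPl/subsetP => x; rewrite !inE => /andP[xv xA].
  by move/cliqueP: clA; apply; rewrite // eq_sym.
rewrite (big_setD1 v vA) /=; set Y := \sum_(_ in _ :\ _) _.
have Y0 : 0 <= Y by apply: sumr_ge0.
have YE : m%:R * (Y / m%:R) = Y.
  case: (posnP m) => [m0|mp]; last by rewrite mulrC divfK // pnatr_eq0 -lt0n.
  by rewrite m0 mul0r /Y (_ : A :\ v = set0) ?big_set0 //; apply/cards0_eq; rewrite cAv.
rewrite cA; apply: le_trans (bin_mean_step m s _ (divr_ge0 Y0 (ler0n _ m))); last first.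
  by rewrite divr_ge0 // addr_ge0.
rewrite YE [_.+1%:R * _]mulrC divfK ?pnatr_eq0 // addrK.
have := IH s.+1 _ cAv clAv; rewrite cAv => IH1.
have := IH s _ cAv clAv; rewrite cAv => IH0.
by apply: lerD IH1 _; apply: ler_wpM2l.
Qed.

(* If [u] and [v] are non-adjacent, the sum is affine when weight is moved    *)
(* between them, so one of the two can be emptied without loss.               *)
Lemma zykov s k A w : (forall v, 0 <= w v) ->
  (forall S, S \subset A -> clique e S -> (#|S| <= k)%N) ->
  clique_sum s A w <= 'C(k, s)%:R * ((\sum_(v in A) w v) / k%:R) ^+ s.
Proof.
move: {2}#|A| (leqnn #|A|) => m; elim: m s A w => [|m IH] s A w cA w0 bA;
  (have [clA|] := boolP (clique e A); first by
    apply: le_trans (clique_sum_clique _ w0 clA) _;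
    apply: bin_mean_mono; [exact: sumr_ge0 | exact: bA]).
  move: cA; rewrite leqn0 cards_eq0 => /eqP ->; case/cliqueP => x y.
  by rewrite inE.
case: s => [|s]; first by rewrite clique_sum0 bin0 mulr1.
case/forall_inPn => u uA /forall_inPn[v vA]; rewrite negb_imply => /andP[nuv nadj].
pose B := A :\ u :\ v.
wlog le_vu : u v uA vA nuv nadj @B /
    clique_sum s (B :&: nbr v) w <= clique_sum s (B :&: nbr u) w.
  have [le|/ltW le] := leP (clique_sum s (B :&: nbr v) w)
    (clique_sum s (B :&: nbr u) w); first by move=> h; apply: (h u v).
  move=> h; apply: (h v u); rewrite // 1?eq_sym 1?e_sym //.
  by rewrite /B [A :\ v :\ u]setDDl setUC -setDDl.
(* Instead of giving [v] weight zero, [v] is removed from the set, so that the induction on [#|A|]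
   applies. *)
pose w' x := if x == u then w u + w v else w x.
have w'0 x : 0 <= w' x by rewrite /w'; case: eqP; rewrite ?addr_ge0.
have uAv : u \in A :\ v by rewrite !inE nuv.
have BE : A :\ v :\ u = B by rewrite /B !setDDl setUC.
have w'B : {in B, w =1 w'}.
  by move=> x; rewrite !inE /w' => /and3P[_ /negbTE ->].
have w'BN : {in B :&: nbr u, w =1 w'} by move=> x /setIP[/w'B].
have NE : (A :\ v) :&: nbr v = B :&: nbr v.
  apply/setP => x; rewrite !inE; case: (eqVneq x u) => [->|] //=.
  by rewrite e_sym (negbTE nadj) !andbF.
have -> : \sum_(x in A) w x = \sum_(x in A :\ v) w' x.
  rewrite (big_setD1 v vA) (big_setD1 u uAv) /= [in RHS](big_setD1 u uAv) /= BE.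
  rewrite {1}/w' eqxx addrA [w v + _]addrC; congr (_ + _).
  exact: eq_bigr.
have cAv : (#|A :\ v| <= m)%N by move: cA; rewrite (cardsD1 v) vA.
apply: le_trans (IH s.+1 _ _ cAv w'0 _); last first.
  by move=> S /subset_trans SA; apply: bA; apply: SA; apply: subD1set.
rewrite (clique_sum_rec _ _ vA) NE !(clique_sum_rec _ _ uAv) BE.
rewrite -(eq_clique_sum _ w'B) -(eq_clique_sum _ w'BN) /w' eqxx.
by rewrite -addrA mulrDl lerD2l lerD2l ler_wpM2l.
Qed.

End WeightedCount.

(** * Five-wheels under a minimum degree condition *)

(** By irreflexivity [x] is a member, so the size is [#|V|] minus the degree of [x]. *)
Definition nonnbr x := [set y | ~~ e x y].

Lemma card_nonnbr x : #|nonnbr x| = \sum_y ~~ e x y.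
Proof. by rewrite -sum1_card big_mkcond; apply: eq_bigr => y _; rewrite inE; case: e. Qed.

Lemma card_nbr_in Q y : #|[set x in Q | e x y]| + \sum_(x in Q) ~~ e x y = #|Q|.
Proof.
rewrite -sum1_card big_mkcond /= -[RHS]sum1_card [in RHS]big_mkcond /=.
rewrite [X in _ + X]big_mkcond -big_split; apply: eq_bigr => x _ /=.
by rewrite inE; case: (x \in Q); case: (e x y).
Qed.

Lemma swap_nonnbr Q :
  \sum_(x in Q) #|nonnbr x| = \sum_y \sum_(x in Q) ~~ e x y.
Proof. by under eq_bigr do rewrite card_nonnbr; rewrite exchange_big. Qed.

Lemma clique_extend Q y :
  clique e Q -> clique e (y |: [set x in Q | e x y]).
Proof.
move=> clQ; apply: cliqueU1; first by move=> x; rewrite inE => /andP[].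
by apply: cliqueS clQ; apply/subsetP => x; rewrite inE => /andP[].
Qed.

(** This covers [y] in [Q] too: [y] is its own non-neighbour, hence dropped and put back. *)
Lemma card_extend Q y :
  #|y |: [set x in Q | e x y]| + \sum_(x in Q) ~~ e x y = #|Q|.+1.
Proof. by rewrite cardsU1 !inE e_irr andbF -addnA card_nbr_in. Qed.

(** For [l = 2] and distinct [Q1], [Q2] this is the 5-cycle [v], [Q1], [w1], [w2], [Q2]. That [v] is
    adjacent to neither [w1] nor [w2] follows from the clique bound. *)
Definition five_wheel l v w1 w2 Q1 Q2 :=
  [/\ clique e Q1, clique e Q2, #|Q1|.+1 = l & #|Q2|.+1 = l] /\
  [/\ {in Q1, forall x, e x v}, {in Q2, forall x, e x v},
      {in Q1, forall x, e x w1}, {in Q2, forall x, e x w2} & e w1 w2].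

Section FiveWheel.
Variable l : nat.
Hypotheses (l_bound : clique_bound e l)
  (deg : forall x, (3 * l - 1) * #|nonnbr x| < 3 * #|V|).

(** [v |: Q] is a clique of the maximal size [l], so no vertex is adjacent to all of it. *)
Lemma nonnbr_in_clique Q v y : clique e Q -> #|Q|.+1 = l ->
  {in Q, forall x, e x v} -> 0 < \sum_(x in Q) ~~ e x y + ~~ e v y.
Proof.
move=> clQ cQ Qv; have vQ : v \notin Q by apply/negP => /Qv; rewrite e_irr.
have clvQ := cliqueU1 Qv clQ.
have /clique_boundP/(_ _ (clique_extend y clvQ)) := l_bound.
have := card_extend (v |: Q) y.
by rewrite (cardsU1 v) big_setU1 //= vQ; lia.
Qed.

(* Counted with multiplicity 3 on [Q1 :&: Q2], the wheel has                  *)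
(* [2 * l + 1 + #|Q1 :&: Q2| <= 3 * l - 1] vertices; by the degree condition  *)
(* some [y] has at most two non-neighbours in it. It then misses exactly one  *)
(* vertex of each [Qi], outside the intersection, and can replace both.       *)
Lemma five_wheel_step v w1 w2 Q1 Q2 : five_wheel l v w1 w2 Q1 Q2 ->
  exists Q1' Q2', five_wheel l v w1 w2 Q1' Q2' /\
    #|Q1' :&: Q2'| = #|Q1 :&: Q2|.+1.
Proof.
case=> -[cl1 cl2 c1 c2] [Q1v Q2v Q1w Q2w ew].
pose miss Q y := \sum_(x in Q) ~~ e x y.
pose total y := miss Q1 y + miss Q2 y + miss (Q1 :&: Q2) y +
  (~~ e v y + ~~ e w1 y + ~~ e w2 y).
have [/existsP[y small]|/existsPn large] := boolP [exists y, total y < 3].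
  have m1v : 0 < miss Q1 y + ~~ e v y := nonnbr_in_clique y cl1 c1 Q1v.
  have m1w : 0 < miss Q1 y + ~~ e w1 y := nonnbr_in_clique y cl1 c1 Q1w.
  have m2v : 0 < miss Q2 y + ~~ e v y := nonnbr_in_clique y cl2 c2 Q2v.
  have m2w : 0 < miss Q2 y + ~~ e w2 y := nonnbr_in_clique y cl2 c2 Q2w.
  have m01 : miss (Q1 :&: Q2) y <= miss Q1 y.
    by rewrite [miss Q1 y](big_setID Q2) leq_addr.
  have m02 : miss (Q1 :&: Q2) y <= miss Q2 y.
    by rewrite setIC [miss Q2 y](big_setID Q1) leq_addr.
  rewrite /total in small.
  (* If [y] missed [v], then [Q1] with [w1] and [Q2] with [w2] would each add a miss, three in all.
     So [y] is adjacent to [v], and the two allowed misses lie in [Q1] and [Q2]. *)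
  have [m1 m2 m0] : [/\ miss Q1 y = 1, miss Q2 y = 1 & miss (Q1 :&: Q2) y = 0].
    by split; lia.
  have [vy w1y w2y] : [/\ e v y, e w1 y & e w2 y] by split; lia.
  exists (y |: [set x in Q1 | e x y]), (y |: [set x in Q2 | e x y]); split.
    split; split; rewrite ?clique_extend //.
    - by have := card_extend Q1 y; rewrite -/(miss Q1 y); lia.
    - by have := card_extend Q2 y; rewrite -/(miss Q2 y); lia.
    - move=> x /setU1P[->|]; first by rewrite e_sym.
      by rewrite inE => /andP[/Q1v].
    - move=> x /setU1P[->|]; first by rewrite e_sym.
      by rewrite inE => /andP[/Q2v].
    - move=> x /setU1P[->|]; first by rewrite e_sym.
      by rewrite inE => /andP[/Q1w].
    - move=> x /setU1P[->|]; first by rewrite e_sym.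
      by rewrite inE => /andP[/Q2w].
  have := card_extend (Q1 :&: Q2) y; rewrite -/(miss _ _) m0 addn0 => <-.
  rewrite -setUIr; congr #|_ |: _|; apply/setP => x; rewrite !inE.
  by case: (e x y); rewrite ?andbF ?andbT.
(* Together with [w1] and [w2] the intersection forms a clique. *)
have k_le : #|Q1 :&: Q2|.+2 <= l.
  have Cw2 : {in Q1 :&: Q2, forall x, e x w2} by move=> x /setIP[_ /Q2w].
  have Cw1 : {in w2 |: Q1 :&: Q2, forall x, e x w1}.
    move=> x /setU1P[->|/setIP[/Q1w] //]; by rewrite e_sym.
  have clC : clique e (Q1 :&: Q2) := cliqueS (subsetIl _ _) cl1.
  have /clique_boundP/(_ _ (cliqueU1 Cw1 (cliqueU1 Cw2 clC))) := l_bound.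
  rewrite cardsU1 cardsU1.
  have -> : w1 \notin w2 |: Q1 :&: Q2 by apply/negP => /Cw1; rewrite e_irr.
  by have -> : w2 \notin Q1 :&: Q2 by apply/negP => /Cw2; rewrite e_irr.
(* The strict degree condition on integers gains 1 per vertex. With weight at most [3 * l - 1] in
   the wheel, the totals multiplied by [3 * l - 1] stay below [(3 * l - 1) * (3 * #|V|)]. *)
have sum_bound Q : (3 * l - 1) * \sum_(x in Q) #|nonnbr x| <= #|Q| * (3 * #|V| - 1).
  rewrite big_distrr -sum_nat_const; apply: leq_sum => x _.
  by have := deg x; rewrite /=; lia.
have : 3 * #|V| <= \sum_y total y.
  rewrite mulnC -sum_nat_const; apply: leq_sum => y _.
  by have := large y; rewrite -leqNgt.
rewrite /total !big_split -!swap_nonnbr -!card_nonnbr /=.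
have := sum_bound Q1; have := sum_bound Q2; have := sum_bound (Q1 :&: Q2).
have := deg v; have := deg w1; have := deg w2.
move: (\sum_(x in Q1) _) (\sum_(x in Q2) _) (\sum_(x in _ :&: _) _) => s1 s2 s0.
move: #|nonnbr v| #|nonnbr w1| #|nonnbr w2| => n0 n1 n2.
have {c1} -> : #|Q1| = l.-1 by lia.
have {c2} -> : #|Q2| = l.-1 by lia.
move: #|Q1 :&: Q2| #|V| k_le => k n k_le d2 d1 d0 b0 b2 b1 ge3.
have : k * (3 * n - 1) <= (l - 2) * (3 * n - 1) by rewrite leq_mul2r; lia.
have : (3 * l - 1) * (3 * n) <= (3 * l - 1) * (s1 + s2 + s0 + (n0 + n1 + n2)).
  by rewrite leq_mul2l ge3 orbT.
nia.
Qed.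

(** Iterating [five_wheel_step] would make the intersection reach size [l], but it lies in [Q1], of
    size [l.-1]. *)
Lemma no_five_wheel v w1 w2 Q1 Q2 : ~ five_wheel l v w1 w2 Q1 Q2.
Proof.
move=> wheel.
have {Q1 Q2 wheel} [Q1 [Q2 [[[_ _ <- _] _]]]] : exists Q1 Q2,
    five_wheel l v w1 w2 Q1 Q2 /\ l <= #|Q1 :&: Q2|.
  elim: {2}l => [|k [R1 [R2 [/five_wheel_step[S1 [S2 [w cS]]] cR]]]].
    by exists Q1, Q2.
  by exists S1, S2; rewrite cS.
by move/leq_trans/(_ (subset_leq_card (subsetIl _ _))); rewrite ltnn.
Qed.

(** Non-adjacency is an equivalence relation, and a maximum clique [K] meets all its classes. A
    vertex gets as colour the position in [enum K] of a member of its class, and [#|K| <= l]. *)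
Lemma colouring_of_multipartite :
  (forall x y z, ~~ e x y -> ~~ e y z -> ~~ e x z) ->
  exists c : V -> 'I_l, forall x y, e x y -> c x != c y.
Proof.
move=> tr; have cl0 : clique e set0 by apply/cliqueP => x y; rewrite inE.
have [K clK maxK] := arg_maxnP (fun S : {set V} => #|S|) cl0.
have miss y : exists x, (x \in K) && ~~ e x y.
  apply/existsP; apply: contraT => /existsPn all_nbr.
  have Ky : {in K, forall x, e x y}.
    by move=> x xK; have := all_nbr x; rewrite xK negbK.
  have := maxK _ (cliqueU1 Ky clK); rewrite cardsU1.
  have /negP -> : ~ y \in K by move/Ky; rewrite e_irr.
  by rewrite /= add1n ltnn.
have cK : #|K| <= l by have /clique_boundP := l_bound; apply.
pose f y := xchoose (miss y).
have fP y : f y \in enum K /\ ~~ e (f y) y.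
  by have /andP[] := xchooseP (miss y); rewrite mem_enum.
have lt_f y : index (f y) (enum K) < l.
  by apply: leq_trans cK; rewrite cardE index_mem; case: (fP y).
exists (fun y => Ordinal (lt_f y)) => x y exy.
apply: contraL exy; rewrite -val_eqE /= => /eqP eqf.
have fxy : f x = f y by apply: index_inj eqf; case: (fP x); case: (fP y).
apply: tr (f x) _ _ _; first by rewrite e_sym; case: (fP x).
by rewrite fxy; case: (fP y).
Qed.

End FiveWheel.

End Cliques.

(** * The Andrasfai-Erdos-Sos theorem by edge-maximality *)

Section AndrasfaiErdosSos.
Variables (V : finType) (l : nat).
Implicit Types e : rel V.

Definition add_edge e v w : rel V :=
  [rel x y | [|| e x y, (x == v) && (y == w) | (x == w) && (y == v)]].

(* In an edge-maximal graph without an [l.+1]-clique, completing a missing    *)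
(* edge [v w] yields the [l.-1]-clique joined to both [v] and [w].            *)
Lemma common_clique e v w : symmetric e -> irreflexive e -> clique_bound e l ->
  v != w -> ~~ clique_bound (add_edge e v w) l ->
  exists Q : {set V}, [/\ clique e Q, #|Q|.+1 = l,
    {in Q, forall x, e x v} & {in Q, forall x, e x w}].
Proof.
move=> e_sym e_irr /clique_boundP bd nvw /forallPn[K].
rewrite negb_imply -ltnNge => /andP[/cliqueP clK gtK].
(* Without an end of the added edge, [K] is a clique of [e], hence has at most [l] vertices. So [K]
   contains both ends and has exactly [l.+1] vertices. *)
have del z : (z == v) || (z == w) -> clique e (K :\ z).
  move=> zvw; apply/cliqueP => x y; rewrite !inE => /andP[xz xK] /andP[yz yK] nxy.
  case/or3P: (clK x y xK yK nxy) => // /andP[/eqP ex /eqP ey];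
    by move: zvw; rewrite -ex -ey ![z == _]eq_sym (negbTE xz) (negbTE yz).
have inK z : (z == v) || (z == w) -> z \in K.
  move/del/bd; apply: contraTT => zK; rewrite -ltnNge.
  by rewrite (cardsD1 z) (negbTE zK) in gtK.
have vK : v \in K by apply: inK; rewrite eqxx.
have wK : w \in K by apply: inK; rewrite eqxx orbT.
have wKv : w \in K :\ v by rewrite !inE eq_sym nvw.
exists (K :\ v :\ w); split.
- by apply: cliqueS (del v _); rewrite ?subD1set ?eqxx.
- have := bd _ (del v _); rewrite eqxx => /(_ isT).
  by move: gtK; rewrite (cardsD1 v) vK (cardsD1 w) wKv /=; lia.
- move=> x; rewrite !inE => /and3P[xw xv xK].
  have := clK x v xK vK xv.
  by rewrite /add_edge /= (negbTE xv) (negbTE xw) !orbF.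
- move=> x; rewrite !inE => /and3P[xw xv xK].
  have := clK x w xK wK xw.
  by rewrite /add_edge /= (negbTE xv) (negbTE xw) !orbF.
Qed.

(** Induction on the number of non-adjacent ordered pairs: a colouring of a supergraph also colours
    [e]. If no edge can be added, [x] and [z] adjacent to each other but not to [v] would give a
    five-wheel, its cliques coming from [common_clique] for [v], [x] and [v], [z]. *)
Lemma andrasfai_erdos_sos e : symmetric e -> irreflexive e ->
  clique_bound e l -> (forall x, (3 * l - 1) * #|nonnbr e x| < 3 * #|V|) ->
  exists c : V -> 'I_l, forall x y, e x y -> c x != c y.
Proof.
pose missing e := [set p : V * V | ~~ e p.1 p.2].
move: {2}#|missing e| (leqnn #|missing e|) => N.
elim: N e => [|N IH] e cN e_sym e_irr bd deg.
  apply: colouring_of_multipartite => // x y z nxy _.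
  move: cN; rewrite leqn0 cards_eq0 => /eqP/setP/(_ (x, y)).
  by rewrite !inE nxy.
pose extendable (p : V * V) :=
  [&& p.1 != p.2, ~~ e p.1 p.2 & clique_bound (add_edge e p.1 p.2) l].
have [/existsP[[v w] /and3P[/= nvw nadj bd']]|/existsPn maximal] :=
    boolP [exists p, extendable p].
  have [||||x|c cP] := IH (add_edge e v w).
  - rewrite -ltnS; apply: leq_trans cN; apply: proper_card.
    apply/properP; split.
      by apply/subsetP => -[x y]; rewrite !inE /= => /norP[].
    by exists (v, w); rewrite inE /= /add_edge /= ?eqxx ?orbT.
  - by move=> x y; rewrite /add_edge /= e_sym ![(_ == _) && (x == _)]andbC [X in _ || X]orbC.
  - move=> x; rewrite /add_edge /= e_irr.
    by case: (eqVneq x v) => [->|_]; rewrite ?(negbTE nvw) ?andbF.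
  - exact: bd'.
  - apply: leq_ltn_trans (deg x); rewrite leq_mul2l; apply/orP; right.
    by apply: subset_leq_card; apply/subsetP => y; rewrite !inE => /norP[].
  by exists c => x y exy; apply: cP; rewrite /add_edge /= exy.
apply: colouring_of_multipartite => // x v z nxv nvz; apply/negP => exz.
have cl w : v != w -> ~~ e v w -> exists Q : {set V}, [/\ clique e Q, #|Q|.+1 = l,
    {in Q, forall x, e x v} & {in Q, forall x, e x w}].
  move=> nvw nadj; apply: common_clique => //.
  by have := maximal (v, w); rewrite /extendable /= nvw nadj.
have [||Q1 [cl1 c1 Q1v Q1x]] := cl x.
- by apply: contraNneq nvz => ->.
- by rewrite e_sym.
have [||Q2 [cl2 c2 Q2v Q2z]] := cl z.
- by apply: contraNneq nxv => ->.
- by [].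
by apply: (no_five_wheel e_sym e_irr bd deg (v := v) (w1 := x) (w2 := z)
  (Q1 := Q1) (Q2 := Q2)).
Qed.

End AndrasfaiErdosSos.

(** * The shadow graph and its link to the hypergraph degrees *)

Section Shadow.
Variables (r : nat) (V : finType) (H : r_graph r V).

Definition shadow : rel V :=
  [rel x y | (x != y) && [exists g in edges H, (x \in g) && (y \in g)]].

Lemma shadow_sym : symmetric shadow.
Proof.
move=> x y; rewrite /shadow /= eq_sym; congr (_ && _).
by apply: eq_existsb => g; rewrite [(x \in g) && _]andbC.
Qed.

Lemma shadow_irr : irreflexive shadow.
Proof. by move=> x; rewrite /shadow /= eqxx. Qed.

Lemma edge_clique g : g \in edges H -> clique shadow g.
Proof.
move=> gH; apply/cliqueP => x y xg yg nxy; rewrite /shadow /= nxy.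
by apply/existsP; exists g; rewrite gH xg yg.
Qed.

(** One covering edge chosen for each pair of an [m.+1]-clique gives at most ['C(m.+1, 2)] edges, a
    forbidden subgraph. *)
Lemma shadow_clique_bound m : K_free m.+1 H -> clique_bound shadow m.
Proof.
move=> free; apply/clique_boundP => K clK; rewrite leqNgt; apply/negP => gtK.
have [S SK cS] : exists2 S : {set V}, S \subset K & #|S| = m.+1.
  have : 0 < #|[set S : {set V} | (S \subset K) && (#|S| == m.+1)]|.
    by rewrite cards_draws bin_gt0.
  by case/card_gt0P => S; rewrite inE => /andP[SK /eqP]; exists S.
have /cliqueP clS := cliqueS SK clK.
pose pairs := [set P : {set V} | (P \subset S) && (#|P| == 2)].
(* The default [set0] is harmless, as [E] keeps only edges of [H]. *)
pose cov (P : {set V}) := odflt set0 [pick g in edges H | P \subset g].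
pose E := [set cov P | P in pairs] :&: edges H.
have uE g : g \in E -> #|g| = r by case/setIP => _; apply: edges_uniform.
apply: (free V (RGraph uE)); last first.
  exists id; split=> // g /=; rewrite imset_id.
  by case/setIP.
split=> /=.
  apply: leq_trans (subset_leq_card (subsetIl _ _)) _.
  by apply: leq_trans (leq_imset_card _ _) _; rewrite cards_draws cS.
exists S; split=> // u v uS vS nuv.
have /andP[_ /existsP[g /and3P[gH ug vg]]] := clS u v uS vS nuv.
have P2 : [set u; v] \in pairs by rewrite inE subUset !sub1set uS vS cards2 nuv.
have [covH] : cov [set u; v] \in edges H /\ [set u; v] \subset cov [set u; v].
  rewrite /cov; case: pickP => [h /andP[]//|/(_ g)] /=.
  by rewrite gH subUset !sub1set ug vg.
rewrite subUset !sub1set => /andP[uc vc].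
by exists (cov [set u; v]); split; rewrite // inE covH imset_f.
Qed.

Lemma min_degree_le v : min_degree H <= degree H v.
Proof.
rewrite /min_degree; elim: (index_enum V) (mem_index_enum v) => // u s IH.
rewrite inE big_cons geq_min => /predU1P[->|/IH ->]; first by rewrite leqnn.
by rewrite orbT.
Qed.

Local Open Scope ring_scope.

(** Deleting [v] maps the edges through [v] injectively to [r.-1]-cliques in its neighbourhood,
    which has no [m.+1]-clique; [zykov] with unit weights counts these. *)
Lemma degree_le v m : (0 < r)%N -> clique_bound shadow m.+1 ->
  (degree H v)%:R <=
    'C(m, r.-1)%:R * (#|nbr shadow v|%:R / m%:R) ^+ r.-1 :> rat.
Proof.
move=> r_gt0 /clique_boundP bd; pose A := nbr shadow v.
have bA (S : {set V}) : S \subset A -> clique shadow S -> (#|S| <= m)%N.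
  move=> /subsetP SA clS.
  have Sv : {in S, forall x, shadow x v} by move=> x /SA; rewrite inE shadow_sym.
  have := bd _ (cliqueU1 shadow_sym Sv clS).
  have /negP vS : ~ v \in S by move=> /Sv; rewrite shadow_irr.
  by rewrite cardsU1 vS.
have := zykov shadow_sym (F := rat) r.-1 (w := fun=> 1) (fun=> ler01) bA.
rewrite sumr_const => /(le_trans _); apply.
rewrite /clique_sum; under eq_bigr do rewrite prodr_const expr1n.
rewrite sumr_const ler_nat /degree.
set D := [set g in _ | _].
have /card_in_imset <- : {in D &, injective (fun g => g :\ v)}.
  move=> g h; rewrite !inE => /andP[_ vg] /andP[_ vh] eq_gh.
  by rewrite -(setD1K vg) eq_gh setD1K.
apply: subset_leq_card; apply/subsetP => _ /imsetP[g + ->].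
rewrite inE => /andP[gH vg]; rewrite unfold_in; apply/and3P; split.
- apply/subsetP => x; rewrite !inE => /andP[xv xg]; rewrite /shadow /= eq_sym xv.
  by apply/existsP; exists g; rewrite gH vg xg.
- by rewrite -(edges_uniform gH) (cardsD1 v g) vg.
- by apply: cliqueS (edge_clique gH); apply: subD1set.
Qed.

End Shadow.

(** * From the degree hypothesis to the partition *)

Local Open Scope ring_scope.

Theorem theorem5p2 (l r : nat) (hr : (3 <= r)%N) (hl : (r <= l)%N)
    (eps : rat)
    (heps : eps = 'C(l.-1, r.-1)%:R *
       (1 / l%:R ^+ r.-1
        - ((3%:R * l%:R - 4%:R) / (3%:R * l%:R ^+ 2 - 4%:R * l%:R + 1)) ^+ r.-1))
    (n : nat) (V : finType) (hn : #|V| = n) (H : r_graph r V)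
    (hfree : K_free l.+1 H)
    (hdeg : (min_degree H)%:R >
       ('C(l.-1, r.-1)%:R / l%:R ^+ r.-1 - eps) * n%:R ^+ r.-1 :> rat) :
  partite l H.
Proof.
have bd := shadow_clique_bound hfree.
have deg x : ((3 * l - 1) * #|nonnbr (shadow H) x| < 3 * #|V|)%N.
  have dn : (#|nbr (shadow H) x| + #|nonnbr (shadow H) x| = n)%N.
    rewrite -hn -(cardC (mem (nbr (shadow H) x))); congr (_ + _)%N.
    by apply: eq_card => y; rewrite !inE.
  suff : ((3 * l - 4) * n < (3 * l - 1) * #|nbr (shadow H) x|)%N.
    rewrite hn -dn; nia.
  rewrite ltnNge; apply/negP => small.
  have l_eq : l = l.-1.+1 by lia.
  have l_ge3 : 3 <= l%:R :> rat by rewrite ler_nat; lia.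
  have le_deg : (degree H x)%:R <= 'C(l.-1, r.-1)%:R *
      (#|nbr (shadow H) x|%:R / l.-1%:R) ^+ r.-1 :> rat.
    by apply: degree_le; [lia | rewrite -l_eq].
  have pred_l : l.-1%:R = l%:R - 1 :> rat by rewrite -subn1 natrB //; lia.
  move: hdeg; apply/negP; rewrite -leNgt.
  apply: le_trans (_ : (degree H x)%:R <= _); first by rewrite ler_nat min_degree_le.
  (* Substituting [eps] cancels the term with [l%:R ^+ r.-1], leaving a multiple of a pure power, so
     it suffices to compare the bases. *)
  apply: le_trans le_deg _; rewrite heps mulrBr mulrA mulr1 subKr -mulrA -exprMn.
  apply: ler_wpM2l => //; apply: lerXn2r; rewrite ?nnegrE ?mulr_ge0 ?invr_ge0 //.
  - lra.
  - nra.
  move: small; rewrite -(ler_nat rat) !natrM !natrB; [|lia|lia].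
  rewrite !natrM => small; rewrite pred_l ler_pdivrMr; last by lra.
  set d := #|_|%:R in small *.
  have -> : (3%:R * l%:R - 4%:R) / (3%:R * l%:R ^+ 2 - 4%:R * l%:R + 1) *
      n%:R * (l%:R - 1) = (3 * l%:R - 4) * n%:R / (3 * l%:R - 1) :> rat.
    have -> : 3 * l%:R ^+ 2 - 4 * l%:R + 1 = (3 * l%:R - 1) * (l%:R - 1) :> rat by ring.
    by field; apply/andP; split; apply/eqP; lra.
  by rewrite ler_pdivlMr; [lra | lra].
have [c cP] := andrasfai_erdos_sos (@shadow_sym _ _ H) (@shadow_irr _ _ H) bd deg.
(* The parts are the colour classes; two vertices of one edge are adjacent in the shadow and so
   differ in colour. *)
exists (fun i => [set x | c x == i]); split.
- apply/setP => x; rewrite !inE; apply/bigcupP.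
  by exists (c x); rewrite // inE.
- move=> i j nij; rewrite -setI_eq0; apply/eqP/setP => x; rewrite !inE.
  by apply: contraNF nij => /andP[/eqP <- /eqP <-].
- move=> g i gH; apply/card_le1_eqP => x y; rewrite !inE.
  move=> /andP[xg /eqP cx] /andP[yg /eqP cy]; apply/eqP; apply: contraT => nxy.
  have /cliqueP/(_ y x yg xg nxy)/cP := edge_clique gH.
  by rewrite cx cy eqxx.
Qed.
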